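(* Let $x_{k+1}=F(x_k,u_k)$, $k\in\mathbb{N}_0$, be a discrete-time control system on a metric space $X$ with control range $U$. If $f\in C(U,\mathbb{R})$ and $Q\subset X$ is a strongly invariant compact set, then the inner invariance pressure and the invariance feedback pressure coincide: $$P_{int}(f,Q)=P_{fb}(f,Q).$$
   Context: Setting. $(X,d)$ is a metric space, $U$ is a topological space, and $F:X\times U\to X$ is a map such that $F(\cdot,u)$ is continuous for every $u\in U$. Put $\mathcal{U}:=U^{\mathbb{N}_0}$. For $x\in X$ and $\omega=(u_k)_{k\in\mathbb{N}_0}\in\mathcal{U}$ the solution is $\varphi(0,x,\omega)=x$, $\varphi(k+1,x,\omega)=F(\varphi(k,x,\omega),u_k)$; $\varphi(k,x,\omega)$ depends only on the first $k$ entries of $\omega$, so it also makes sense for finite control sequences of length at least $k$. $C(U,\mathbb{R})$ is the set of continuous functions $U\to\mathbb{R}$. A compact set $Q\subset X$ with nonempty interior is strongly invariant if for every $x\in Q$ there is $u\in U$ with $F(x,u)\in\mathrm{int}\,Q$. Convention: $\log 0=-\infty$. Inner invariance pressure. For $n\in\mathbb{N}$, a set $\mathcal{S}\subset\mathcal{U}$ is strongly $(n,Q)$-spanning if for each $x\in Q$ there is $\omega\in\mathcal{S}$ with $\varphi(i,x,\omega)\in\mathrm{int}\,Q$ for $i=1,\dots,n$. For $\omega=(u_i)$ let $(S_nf)(\omega)=\sum_{i=0}^{n-1}f(u_i)$, and $a_n(f,Q)=\inf\{\sum_{\omega\in\mathcal{S}}e^{(S_nf)(\omega)}:\mathcal{S}\text{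 strongly }(n,Q)\text{-spanning}\}$. Then $P_{int}(f,Q)=\lim_{n\to\infty}\frac1n\log a_n(f,Q)$ (the limit exists in $[-\infty,\infty)$). Feedback pressure. An invariant open cover $\mathcal{C}=(\mathcal{A},\tau,G)$ of $Q$ consists of $\tau\in\mathbb{N}$, a finite open cover $\mathcal{A}$ of $Q$ (by sets open in the relative topology of $Q$), and a map $G:\mathcal{A}\to U^{\tau}$ such that $\varphi(k,A,G(A))\subset\mathrm{int}\,Q$ for all $A\in\mathcal{A}$ and $k\in\{1,\dots,\tau\}$. For a sequence $\alpha=(A_i)_{i\in\mathbb{N}_0}\in\mathcal{A}^{\mathbb{N}_0}$ let $\omega(\alpha)=(u_0,u_1,\dots)$ be the concatenation of the blocks $G(A_0),G(A_1),\dots$, i.e. $(u_l)_{l=(i-1)\tau}^{i\tau-1}=G(A_{i-1})$ for all $i\ge1$. For $n\in\mathbb{N}$ let $B_n(\alpha)=\{x\in X:\varphi(i\tau,x,\omega(\alpha))\in A_i\text{ for }i=0,1,\dots,n-1\}$. The family $\mathcal{B}_n(\mathcal{C})=\{B_n(\alpha):\alpha\in\mathcal{A}^{\mathbb{N}_0}\}$ is a finite open cover of $Q$; only the first $n$ elements of $\alpha$ (and hence the first $n\tau$ entries of $\omega(\alpha)$) are relevant, and sequences are identified accordingly. A set $\mathcal{W}_n=\{\omega(\alpha_i):i\in I\}$, $\alpha_i\in\mathcal{A}^{\mathbb{N}_0}$, is generating (of length $n\tau$) for $\mathcal{C}$ if the sets $B_n(\alpha_i)$, $i\in I$, form a subcover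 of $\mathcal{B}_n(\mathcal{C})$ (they cover $Q$) that is minimal in the sense that none of its elements may be omitted in order to cover $Q$. Put $q_n(f,Q,\mathcal{C})=\inf\{\sum_{\omega\in\mathcal{W}_n}e^{(S_{n\tau}f)(\omega)}:\mathcal{W}_n\text{ generating for }\mathcal{C}\}$, where $(S_{n\tau}f)(\omega)=\sum_{i=0}^{n\tau-1}f(u_i)$; $P_{fb}(f,Q,\mathcal{C})=\lim_{n\to\infty}\frac{1}{n\tau}\log q_n(f,Q,\mathcal{C})$ (the limit exists), and $P_{fb}(f,Q)=\inf\{P_{fb}(f,Q,\mathcal{C}):\mathcal{C}\text{ an invariant open cover of }Q\}$. *)

(* Defs.v *)
From HB Require Import structures.
From mathcomp Require Import all_boot all_order all_algebra.
From mathcomp Require Import all_classical all_reals all_analysis.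
Set Implicit Arguments.
Unset Strict Implicit.
Unset Printing Implicit Defensive.
Import Order.TTheory GRing.Theory Num.Theory.
Import numFieldNormedType.Exports.
Local Open Scope classical_set_scope.
Local Open Scope ring_scope.

Section ControlSystem.
Context {R : realType} {X : metricType R} {U : topologicalType}.
Implicit Types (F : X -> U -> X) (Q : set X) (f : U -> R) (w : nat -> U).

Fixpoint phi F (k : nat) (x : X) w : X :=
  if k is k'.+1 then F (phi F k' x w) (w k') else x.

(* The solution along a finite control word, evaluated at its first k letters;
   meaningful for k <= size s. *)
Definition phi_word F (k : nat) (x : X) (s : seq U) : X := foldl F x (take k s).

Lemma phi_wordE F k n x w : (k <= n)%N ->
  phi_word F k x (mkseq w n) = phi F k x w.
Proof.
rewrite /phi_word => kn; have -> : take k (mkseq w n) = mkseq w k.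
  by rewrite /mkseq -map_take take_iota (minn_idPl kn).
by elim: k {kn} => // k IHk; rewrite mkseqS foldl_rcons IHk.
Qed.

Definition strongly_invariant F Q : Prop :=
  [/\ compact Q, Q° !=set0 & forall x, Q x -> exists u, Q° (F x u)].

Definition Birkhoff f (s : seq U) : R := \sum_(u <- s) f u.

Definition strongly_spanning F Q (n : nat) (S : set (nat -> U)) : Prop :=
  forall x, Q x -> exists2 w, S w &
    forall i, (1 <= i <= n)%N -> Q° (phi F i x w).

Definition a_ F f Q (n : nat) : \bar R :=
  ereal_inf [set \esum_(w in S) (expR (Birkhoff f (mkseq w n)))%:E
            | S in strongly_spanning F Q n].

(* [lne 0 = -oo]; the value at n = 0 is irrelevant to the limit. *)
Definition P_int F f Q : \bar R :=
  limn (fun n => ((n%:R^-1)%:E * lne (a_ F f Q n))%E).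

(* [cov] is coerced to the type of its elements, so that [cov -> _] is the
   type of maps defined on the cover only. *)
Record inv_open_cover F Q := InvOpenCover {
  cov : set (set X);
  tau : nat;
  feedback : cov -> tau.-tuple U;
  tau_gt0 : (0 < tau)%N;
  cov_finite : finite_set cov;
  cov_open : forall A, cov A -> exists2 O, open O & A = Q `&` O;
  cov_cover : Q `<=` \bigcup_(A in cov) A;
  cov_invariant : forall (A : cov) k, (1 <= k <= tau)%N ->
    [set phi_word F k x (feedback A) | x in set_val A] `<=` Q° }.

Section Feedback.
Variables (F : X -> U -> X) (Q : set X) (C : inv_open_cover F Q).
Implicit Types alpha : nat -> cov C.

Definition omega alpha (l : nat) : U :=
  tnth (feedback (alpha (l %/ tau C)%N)) (Ordinal (ltn_pmod l (tau_gt0 C))).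

Definition B_ (n : nat) alpha : set X :=
  [set x | forall i, (i < n)%N ->
     set_val (alpha i) (phi F (i * tau C)%N x (omega alpha))].

(* Minimality is required of the family indexed by I; it forces [B_ n] to be
   injective on I, hence I to contain at most one representative of each word
   of length n over the cover. *)
Definition minimal_subcover (n : nat) (I : set (nat -> cov C)) : Prop :=
  Q `<=` \bigcup_(alpha in I) B_ n alpha /\
  forall alpha, I alpha -> ~ (Q `<=` \bigcup_(beta in I `\ alpha) B_ n beta).

(* Controls are identified when their first n * tau entries agree, whence the
   words; W is a set, so a word arising from two different alpha counts once. *)
Definition generating (n : nat) (W : set (seq U)) : Prop :=
  exists2 I, minimal_subcover n I &
    W = [set mkseq (omega alpha) (n * tau C)%N | alpha in I].

Definition q_ f (n : nat) : \bar R :=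
  ereal_inf [set \esum_(s in W) (expR (Birkhoff f s))%:E
            | W in generating n].

Definition P_fb_cover f : \bar R :=
  limn (fun n => ((((n * tau C)%N%:R)^-1)%:E * lne (q_ f n))%E).

End Feedback.

Definition P_fb F f Q : \bar R :=
  ereal_inf [set P_fb_cover C f | C in [set: inv_open_cover F Q]].

End ControlSystem.

(* Main.v *)
(** For [P_int <= P_fb]: if the words of a generating set of length [n * tau]
    are used as open-loop controls, they form a strongly [(n * tau, Q)]-spanning
    set, because every block of a feedback word keeps its cover element inside
    the interior of [Q].
    For [P_fb <= P_int]: by compactness a strongly [(n, Q)]-spanning set [S] has
    a finite strongly spanning subset [D]; the sets of points of [Q] that stay
    in the interior of [Q] under [w], for [w] in [D], together with the control
    words themselves form an invariant open cover with [tau = n], and its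
    one-step generating sets consist of words of [D].
    Only finite [n] are compared, since both limits are infima: [a_ n] and
    [q_ n] are submultiplicative, by concatenation of controls. *)
Require Import Defs.
From HB Require Import structures.
From mathcomp Require Import all_boot all_order all_algebra finmap.
From mathcomp Require Import all_classical all_reals all_analysis.
Import Order.TTheory GRing.Theory Num.Theory.
Import numFieldNormedType.Exports.
Local Open Scope classical_set_scope.
Local Open Scope ring_scope.
Set Implicit Arguments.
Unset Strict Implicit.
Unset Printing Implicit Defensive.

(** * Finite subcovers: compactness and minimality *)

Lemma compact_finite_subcover (T : topologicalType) (I : choiceType)
    (K : set T) (D : set I) (f : I -> set T) :
  compact K -> (forall i, D i -> open (f i)) -> K `<=` \bigcup_(i in D) f i ->
  exists D', [/\ finite_set D', D' `<=` D & K `<=` \bigcup_(i in D') f i].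
Proof.
move=> cK fO Kf; have [->|/set0P[x0 _]] := eqVneq K set0.
  by exists set0; split => //; exact: sub0set.
(* [compact_cover] is stated on pointed spaces; a point of [K] serves as base point, hence the
   separate case of empty [K]. *)
pose T' : ptopologicalType := HB.pack T (isPointed.Build T x0).
have : @cover_compact T' K by rewrite -compact_cover.
move=> /(_ I D f fO Kf)[D' D'D KD']; exists [set` D']; split => //.
by move=> i /D'D; rewrite inE.
Qed.

(** Redundant indices are discarded one at a time, by induction on the cardinality of [I]. *)
Lemma finite_subcover_minimal (T X : Type) (Q : set X) (I : set T)
    (B : T -> set X) :
  finite_set I -> Q `<=` \bigcup_(i in I) B i ->
  exists J, [/\ J `<=` I, Q `<=` \bigcup_(i in J) B i &
    forall i, J i -> ~ (Q `<=` \bigcup_(j in J `\ i) B j)].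
Proof.
move=> /finite_setP[n]; elim: n I => [|n IHn] I.
  by rewrite II0 card_eq0 => /eqP -> QB; exists set0; split.
move=> In QB.
have [min|/existsNP[i /not_implyP[Ii /contrapT QBi]]] :=
    pselect (forall i, I i -> ~ (Q `<=` \bigcup_(j in I `\ i) B j)).
  by exists I; split.
have [k Ik] : exists k, (I `\ i #= `I_k)%card.
  apply/finite_setP/(@sub_finite_set _ _ I) => [j []//|].
  by apply/finite_setP; exists n.+1.
have /card_eq_II[kn] : (`I_k.+1 #= `I_n.+1)%card.
  by apply: card_eq_trans In; rewrite card_eq_sym; apply/eq_cardSP; exists i.
have [|J [JI QJ minJ]] := IHn (I `\ i) _ QBi; first by rewrite -kn.
by exists J; split => // j /JI[].
Qed.

(** * Sums over images and products of index sets *)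

Lemma subset_esum (R : realType) (T : choiceType) (A B : set T)
    (a : T -> \bar R) :
  A `<=` B -> (\esum_(i in A) a i <= \esum_(i in B) a i)%E.
Proof.
move=> AB; apply: ge_ereal_sup => _ [D [finD DA] <-].
by apply: ereal_sup_ubound; exists D => //; split=> // i /DA /AB.
Qed.

(** Choosing one preimage per point gives an injective section of [e], so the left sum runs over a
    part of [P]. Thus identifying controls with equal words never raises a sum. *)
Lemma esum_image_le (R : realType) (T T' : choiceType) (P : set T)
    (e : T -> T') (a : T' -> \bar R) :
  (\esum_(j in e @` P) a j <= \esum_(i in P) a (e i))%E.
Proof.
have [->|/set0P[i0 _]] := eqVneq P set0; first by rewrite image_set0 !esum_set0.
have /choice[g gP] j : exists i, (e @` P) j -> P i /\ e i = j.
  have [[i Pi ij]|nPj] := pselect ((e @` P) j); first by exists i.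
  by exists i0.
have geP : g @` (e @` P) `<=` P by move=> _ [j /gP[Pgj _] <-].
have <- : e @` (g @` (e @` P)) = e @` P.
  apply/seteqP; split=> [|j ePj]; first exact: image_subset.
  by have [_ <-] := gP _ ePj; exists (g j) => //; exists j.
rewrite esum_image; first exact: subset_esum.
move=> _ _ /set_mem[i /gP[_ gi] <-] /set_mem[j /gP[_ gj] <-].
by rewrite gi gj => ->.
Qed.

Lemma esumZ_le (R : realType) (T : choiceType) (P : set T) (c : \bar R)
    (a : T -> \bar R) : (0 <= c)%E -> (forall i, 0 <= a i)%E ->
  (\esum_(i in P) (c * a i) <= c * \esum_(i in P) a i)%E.
Proof.
move=> c0 a0; apply: ge_ereal_sup => _ [D DP <-].
by rewrite -ge0_mule_fsumr// lee_wpmul2l// ereal_sup_ubound//; exists D.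
Qed.

(** The source of submultiplicativity: [h] will be a concatenation, and pairs with the same
    concatenation are counted once on the left. *)
Lemma esum_image2_le (R : realType) (T1 T2 T : choiceType) (A : set T1)
    (B : set T2) (h : T1 -> T2 -> T) (a : T1 -> \bar R) (b : T2 -> \bar R)
    (c : T -> \bar R) :
  (forall i, 0 <= a i)%E -> (forall j, 0 <= b j)%E ->
  (forall i j, c (h i j) = a i * b j)%E ->
  (\esum_(k in [set h i j | i in A & j in B]) c k <=
   (\esum_(i in A) a i) * (\esum_(j in B) b j))%E.
Proof.
move=> a0 b0 cE; rewrite image2E (le_trans (esum_image_le _ _ _))//.
rewrite (eq_esum (b := fun k => (a k.1 * b k.2)%E)) => [|[i j] _]; last first.
  exact: cE.
have -> : A `*` B = A `*`` (fun=> B) by [].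
rewrite -(esum_esum (a := fun i j => a i * b j)%E) => [|i j _ _]; last first.
  exact: mule_ge0.
apply: (@le_trans _ _ (\esum_(i in A) ((\esum_(j in B) b j) * a i)%E)).
  by apply: le_esum => i _; rewrite muleC; exact: esumZ_le.
rewrite muleC; apply: esumZ_le => //; exact: esum_ge0.
Qed.

(** * Extended logarithms and limits of submultiplicative sequences *)

Lemma lte_dense_EFin (R : realFieldType) (x y : \bar R) :
  (x < y)%E -> exists c : R, (x < c%:E < y)%E.
Proof.
case: x y => [x||] [y||]//=.
- by rewrite lte_fin => xy; exists ((x + y) / 2); rewrite !lte_fin !midf_lt.
- by move=> _; exists (x + 1); rewrite lte_fin ltrDl ltr01 ltry.
- by move=> _; exists (y - 1); rewrite ltNyr lte_fin ltrBlDr ltrDl ltr01.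
- by move=> _; exists 0; rewrite ltNyr ltry.
Qed.

Lemma cvgn_to_lower_bound (R : realType) (u : (\bar R)^nat) (l : \bar R) :
  (forall n, (0 < n)%N -> l <= u n)%E ->
  (forall c : R, (l < c%:E)%E -> \forall n \near \oo, (u n <= c%:E)%E) ->
  u @ \oo --> l.
Proof.
(* The shift drops the term [n = 0], on which the lower bound says nothing. A real strictly between
   [l] and the limsup would bound a tail, which is absurd. *)
move=> lu ul; rewrite -(cvg_shiftn 1); apply: limn_esup_le_cvg => [|n].
  rewrite leNgt; apply/negP => /lte_dense_EFin[c /andP[/ul[N _ Nc]]].
  rewrite ltNge => /negP; apply; rewrite /limn_esup limf_esupE.
  apply: ge_ereal_inf; eexists.
    by exists [set n | (N <= n)%N] => //; exists N.
  apply: ge_ereal_sup => _ [n Nn <-]; apply: Nc => /=.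
  by rewrite (leq_trans Nn)// leq_addr.
by rewrite /= lu// addn1.
Qed.

Lemma le_lne (R : realType) (x y : \bar R) :
  (0 <= x)%E -> (x <= y)%E -> (lne x <= lne y)%E.
Proof.
by move=> x0 xy; rewrite (@lee_lne R x y) ?in_itv/= ?leey ?x0 ?(le_trans x0).
Qed.

Lemma lne_lt (R : realType) (x c : \bar R) :
  (0 <= x)%E -> (lne x < c)%E = (x < expeR c)%E.
Proof.
by move=> x0; rewrite -[c in LHS]expeRK lte_lne// in_itv/= leey ?x0 ?expeR_ge0.
Qed.

Lemma lne_le (R : realType) (x c : \bar R) :
  (0 <= x)%E -> (lne x <= c)%E = (x <= expeR c)%E.
Proof.
move=> x0; rewrite -[c in LHS]expeRK.
by apply: lee_lne; rewrite in_itv/= leey ?x0 ?expeR_ge0.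
Qed.

(** Fekete's lemma for the submultiplicative sequence [ereal_inf (A n)]. The
    comparison is made on members of [A n] so that the bounds stay real even if
    some infimum is 0. *)
Lemma limn_lne_inf_submul (R : realType) (t : nat) (A : nat -> set (\bar R)) :
  (0 < t)%N ->
  (forall n x, A n x -> 0 <= x)%E ->
  (exists2 x, A 1%N x & x < +oo)%E ->
  (forall m n x y, (0 < m)%N -> (0 < n)%N -> A m x -> A n y ->
    exists2 z, A (m + n)%N z & z <= x * y)%E ->
  limn (fun n => (((n * t)%N%:R^-1)%:E * lne (ereal_inf (A n)))%E) =
  ereal_inf [set (((n * t)%N%:R^-1)%:E * lne (ereal_inf (A n)))%E
            | n in [set n | (0 < n)%N]].
Proof.
move=> t0 A0 [y A1y yoo] AM; apply/cvg_lim => //; set l := ereal_inf _.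
have tn0 n : (0 < n)%N -> 0 < (n * t)%:R :> R.
  by move=> n0; rewrite ltr0n muln_gt0 n0.
have infA0 n : (0 <= ereal_inf (A n))%E.
  by apply: le_ereal_inf_tmp => x; exact: A0.
apply: cvgn_to_lower_bound => [n n0|c lc].
  by apply: ereal_inf_lbound; exists n.
(* The gap [c - c'] will absorb the error [m * ln D / n] left by the division of [n] by [m]. *)
have [c' lc' c'c] : exists2 c' : R, (l < c'%:E)%E & c' < c.
  have [c' /andP[lc' c'c]] := lte_dense_EFin lc.
  by exists c'; rewrite -?lte_fin.
have [_ [m /= m0 <-]] := ereal_inf_lt lc'.
rewrite lte_pdivrMl ?tn0//.
rewrite lne_lt ?infA0//=.
move=> /ereal_inf_lt[x Amx xlt].
(* [D] measures the excess of the chosen member of [A 1] over the rate [rho];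
   it is paid at most [m] times when [n] is divided by [m]. *)
pose rho := expR (t%:R * c').
have rho0 : 0 < rho by exact: expR_gt0.
have [D D1 yD] : exists2 D : R, 1 <= D & (y <= (rho * D)%:E)%E.
  exists (Num.max 1 (fine y / rho)); first by rewrite le_max lexx.
  rewrite -[leLHS]fineK ?ge0_fin_numE ?(A0 _ _ A1y)//.
  by rewrite lee_fin mulrC -ler_pdivrMr// le_max lexx orbT.
have D0 : 0 < D := lt_le_trans ltr01 D1.
have xrho : (x <= (rho ^+ m)%:E)%E.
  rewrite (le_trans (ltW xlt))//= lee_fin -expRM_natl.
  by rewrite natrM mulrA.
(* Multiplies [q] copies of [x] and [r.+1] copies of [y]. The remainder is kept positive because
   [AM] only joins positive lengths; accordingly [n.-1], not [n], is divided by [m] below. *)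
have bound q r : exists2 z, A (q * m + r.+1)%N z &
    (z <= (rho ^+ (q * m + r.+1) * D ^+ r.+1)%:E)%E.
  elim: q => [|q [z Az zle]].
    elim: r => [|r [z Az zle]].
      by exists y => //; rewrite mul0n add0n !expr1.
    have [z' Az' z'le] := AM _ _ _ _ (ltn_addl _ (ltn0Sn r)) (ltn0Sn 0) Az A1y.
    exists z'; first by move: Az'; rewrite -addnA addn1.
    rewrite (le_trans z'le)// (le_trans (lee_pmul _ _ zle yD))//.
    - exact: A0 Az.
    - exact: A0 A1y.
    by rewrite -EFinM lee_fin mulrACA -!exprSr addnS.
  have [z' Az' z'le] := AM _ _ _ _ m0 (ltn_addl _ (ltn0Sn r)) Amx Az.
  exists z'; first by move: Az'; rewrite addnA -mulSn.
  rewrite (le_trans z'le)// (le_trans (lee_pmul _ _ xrho zle))//.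
  - exact: A0 Amx.
  - exact: A0 Az.
  by rewrite -EFinM lee_fin mulrA -exprD addnA -mulSn.
have lebound n : (0 < n)%N ->
    (lne (ereal_inf (A n)) <= ((n * t)%:R * c' + m%:R * ln D)%:E)%E.
  move=> n0;
  have [z Az zle] := bound (n.-1 %/ m)%N (n.-1 %% m)%N.
  move: Az zle; rewrite addnS -divn_eq prednK// => Az zle.
  rewrite lne_le ?infA0//=.
  rewrite (le_trans (ereal_inf_lbound Az))// (le_trans zle)// lee_fin.
  rewrite expRD ler_pM ?exprn_ge0 ?(ltW rho0) ?(ltW D0)//.
    by rewrite -expRM_natl natrM mulrA.
  by rewrite expRM_natl lnK// ler_weXn2l// ltn_pmod.
have near_n : \forall n \near \oo, m%:R * ln D <= n%:R * (c - c').
  have /= := nbhs_infty_ger (m%:R * ln D / (c - c')).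
  by apply: filterS => n; rewrite ler_pdivrMr ?subr_gt0.
near=> n.
have n0 : (0 < n)%N by near: n; exists 1%N.
rewrite lee_pdivrMl ?tn0// (le_trans (lebound _ n0))// -EFinM lee_fin.
rewrite addrC -lerBrDr -mulrBr.
have : m%:R * ln D <= n%:R * (c - c') by near: n.
move=> /le_trans; apply; rewrite ler_wpM2r ?subr_ge0 ?(ltW c'c)// ler_nat.
by rewrite leq_pmulr.
Unshelve. all: by end_near.
Qed.

(** * Weights, solutions and concatenation of controls *)

Section Systems.
Context {R : realType} {X : metricType R} {U : topologicalType}.
Implicit Types (F : X -> U -> X) (Q : set X) (f : U -> R) (w v : nat -> U).

Definition weight f (s : seq U) : \bar R := (expR (Birkhoff f s))%:E.

Lemma weight_ge0 f s : (0 <= weight f s)%E.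
Proof. by rewrite lee_fin expR_ge0. Qed.

Lemma weight_cat f s1 s2 : weight f (s1 ++ s2) = (weight f s1 * weight f s2)%E.
Proof. by rewrite /weight /Birkhoff big_cat expRD EFinM. Qed.

Lemma esum_finite_ltoo (T : choiceType) (A : set T) f (g : T -> seq U) :
  finite_set A -> (\esum_(i in A) weight f (g i) < +oo)%E.
Proof.
move=> finA; rewrite esum_fset// => [|i _]; last exact: weight_ge0.
rewrite fsbig_finite//=; apply/lte_sum_pinfty => i _; exact: ltry.
Qed.

Lemma eq_phi F k x w v :
  (forall i, (i < k)%N -> w i = v i) -> phi F k x w = phi F k x v.
Proof.
elim: k => //= k IHk wv; rewrite wv// IHk// => i ik.
by rewrite wv// (ltn_trans ik).
Qed.

Lemma phi_add F m k x w :
  phi F (m + k) x w = phi F k (phi F m x w) (fun l => w (m + l)%N).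
Proof. by elim: k => [|k IHk]; rewrite ?addn0// addnS /= IHk. Qed.

Lemma phi_continuous F k w :
  (forall u, continuous (F ^~ u)) -> continuous (fun x => phi F k x w).
Proof.
move=> cF; elim: k => [x|k IHk x]; first exact: cvg_id.
exact: (cvg_comp _ _ (IHk x) (cF _ _)).
Qed.

(** Polymorphic, since it joins both controls and sequences of cover elements. *)
Definition splice (T : Type) m (w v : nat -> T) : nat -> T :=
  fun k => if (k < m)%N then w k else v (k - m)%N.

Lemma spliceD (T : Type) m (w v : nat -> T) k : splice m w v (m + k) = v k.
Proof. by rewrite /splice ltnNge leq_addr addKn. Qed.

Lemma mkseq_splice (T : Type) m n (w v : nat -> T) :
  mkseq (splice m w v) (m + n) = mkseq w m ++ mkseq v n.
Proof.
rewrite /mkseq iotaD map_cat add0n; congr (_ ++ _).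
  by apply/eq_in_map => k; rewrite mem_iota /splice => /= ->.
rewrite -[X in iota X]addn0 iotaDl -map_comp.
by apply: eq_map => k /=; rewrite spliceD.
Qed.

Lemma phi_splice F m k x w v : (k <= m)%N ->
  phi F k x (splice m w v) = phi F k x w.
Proof. by move=> km; apply: eq_phi => i ik; rewrite /splice (leq_trans ik). Qed.

Lemma phi_spliceD F m k x w v :
  phi F (m + k) x (splice m w v) = phi F k (phi F m x w) v.
Proof.
rewrite phi_add phi_splice//; apply: eq_phi => i _; exact: spliceD.
Qed.

(** Time 0 is left unconstrained, so that the set is open in [X]: a finite intersection of preimages
    of the interior of [Q]. *)
Definition inner_entry F Q n w : set X :=
  [set x | forall i, (1 <= i <= n)%N -> Q° (phi F i x w)].

Lemma open_inner_entry F Q n w :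
  (forall u, continuous (F ^~ u)) -> open (inner_entry F Q n w).
Proof.
move=> cF; elim: n => [|n IHn].
  rewrite (_ : inner_entry _ _ _ _ = setT); first exact: openT.
  by apply/seteqP; split=> // x _ [].
rewrite (_ : inner_entry _ _ _ _ =
    inner_entry F Q n w `&` (fun x => phi F n.+1 x w) @^-1` Q°).
  apply: openI => //; apply: open_comp; last exact: open_interior.
  by move=> x _; apply: phi_continuous.
apply/seteqP; split=> [x Hx|x [Hx Hn] i /andP[i0]].
  split=> [i /andP[i0 ik]|]; apply: Hx; last by rewrite leqnn.
  by rewrite i0 (leq_trans ik).
by rewrite leq_eqVlt => /orP[/eqP->//|iSn]; apply: Hx; rewrite i0.
Qed.

(** * The inner pressure as an infimum *)

Section Inner.
Context F Q (cF : forall u, continuous (F ^~ u)) (hQ : strongly_invariant F Q).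

Lemma strongly_spanning_finite n (S : set (nat -> U)) :
  strongly_spanning F Q n S ->
  exists D, [/\ finite_set D, D `<=` S & strongly_spanning F Q n D].
Proof.
move=> spS; have [cQ _ _] := hQ.
have [||D [finD DS QD]] :=
    compact_finite_subcover cQ (D := S) (f := inner_entry F Q n).
- by move=> w _; exact: open_inner_entry.
- by move=> x /spS[w Sw Hw]; exists w.
by exists D; split => // x /QD[w Dw Hw]; exists w.
Qed.

(** A choice [g] of admissible controls acts as a feedback law that keeps the trajectory in [Q]; its
    values along the trajectory form an open-loop control. With compactness this makes [a_ F f Q 1]
    finite from above. *)
Lemma strongly_spanning_setT n : strongly_spanning F Q n setT.
Proof.
have [_ _ inv] := hQ => x Qx.
have [u0 _] := inv x Qx.
have /choice[g gP] y : exists u, Q y -> Q° (F y u).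
  have [/inv[u Hu]|nQy] := pselect (Q y); first by exists u.
  by exists u0.
pose traj k := iter k (fun y => F y (g y)) x.
pose w k := g (traj k).
have phiE k : phi F k x w = traj k by elim: k => //= k ->.
have Qtraj k : Q (traj k).
  by elim: k => //= k /gP; exact: interior_subset.
by exists w => // -[//|i] _; rewrite phiE /=; exact: gP.
Qed.

Lemma strongly_spanning_splice m n S T :
  (0 < m)%N -> strongly_spanning F Q m S -> strongly_spanning F Q n T ->
  strongly_spanning F Q (m + n) [set splice m w v | w in S & v in T].
Proof.
move=> m0 spS spT x Qx; have [w Sw Hw] := spS x Qx.
(* As [0 < m], time [m] is among the controlled times, so the state there lies in [Q] and [T]
   applies to it. *)
have [|v Tv Hv] := spT (phi F m x w).
  by apply: interior_subset; apply: Hw; rewrite m0 leqnn.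
exists (splice m w v); first by exists w => //; exists v.
move=> i /andP[i0 imn]; have [im|mi] := leqP i m.
  by rewrite phi_splice//; apply: Hw; rewrite i0.
rewrite -(subnKC (ltnW mi)) phi_spliceD; apply: Hv.
by rewrite subn_gt0 mi leq_subLR.
Qed.

Lemma P_intE f :
  P_int F f Q = ereal_inf [set ((n%:R^-1)%:E * lne (a_ F f Q n))%E
                          | n in [set n | (0 < n)%N]].
Proof.
pose A n := [set \esum_(w in S) weight f (mkseq w n)
            | S in strongly_spanning F Q n].
have := @limn_lne_inf_submul R 1 A isT.
have -> : (fun n => (((n * 1)%:R^-1)%:E * lne (ereal_inf (A n)))%E) =
          (fun n => ((n%:R^-1)%:E * lne (a_ F f Q n))%E).
  by apply/funext => n; rewrite muln1.
apply.
- by move=> n _ [S _ <-]; apply: esum_ge0 => w _; exact: weight_ge0.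
- have [D [finD _ spD]] := strongly_spanning_finite (@strongly_spanning_setT 1).
  by eexists; [exists D => //|exact: esum_finite_ltoo].
- move=> m n _ _ m0 n0 [S spS <-] [T spT <-].
  eexists; first by exists [set splice m w v | w in S & v in T] => //;
    exact: strongly_spanning_splice.
  apply: esum_image2_le => [w|v|w v]; rewrite ?weight_ge0//.
  by rewrite mkseq_splice weight_cat.
Qed.

End Inner.

(** * Feedback controls and their generating sets *)

Section Cover.
Context F Q (C : inv_open_cover F Q).
Implicit Types alpha beta : nat -> cov C.

Lemma omegaE u0 alpha l :
  omega alpha l = nth u0 (feedback (alpha (l %/ tau C)%N)) (l %% tau C).
Proof. by rewrite /omega (tnth_nth u0). Qed.

Lemma mkseq_omega_block alpha i :
  mkseq (fun j => omega alpha (i * tau C + j)%N) (tau C) = feedback (alpha i).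
Proof.
have t0 := tau_gt0 C.
apply: (@eq_from_nth _ (omega alpha 0)) => [|j]; rewrite size_mkseq.
  by rewrite size_tuple.
move=> jt; rewrite nth_mkseq// (omegaE (omega alpha 0)).
by rewrite divnMDl// divn_small// addn0 modnMDl modn_small.
Qed.

Lemma eq_omega n alpha beta l : (forall i, (i < n)%N -> alpha i = beta i) ->
  (l < n * tau C)%N -> omega alpha l = omega beta l.
Proof.
by move=> ab ln; rewrite /omega ab// ltn_divLR// tau_gt0.
Qed.

Lemma omega_splice m alpha beta :
  omega (splice m alpha beta) = splice (m * tau C) (omega alpha) (omega beta).
Proof.
apply/funext => l; rewrite {2}/splice; case: ltnP => lm.
  by apply: (@eq_omega m) => // i im; rewrite /splice im.
rewrite (omegaE (omega alpha 0)) [RHS](omegaE (omega alpha 0)).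
rewrite -[in LHS](subnKC lm) divnMDl ?tau_gt0//.
by rewrite spliceD modnMDl.
Qed.

Lemma phi_block alpha i k x : (k <= tau C)%N ->
  phi F (i * tau C + k) x (omega alpha) =
  phi_word F k (phi F (i * tau C) x (omega alpha)) (feedback (alpha i)).
Proof. by move=> kt; rewrite phi_add -mkseq_omega_block phi_wordE. Qed.

Lemma B_inner_entry n alpha x :
  B_ n alpha x -> inner_entry F Q (n * tau C) (omega alpha) x.
Proof.
move=> Bx j /andP[j0 jn]; have t0 := tau_gt0 C.
(* Invariance covers times 1 to [tau C] of a block, so a multiple of [tau C] must count as the end
   of a block. Dividing [j.-1] does this and keeps the block index below [n] even at the final
   time. *)
have -> : j = (j.-1 %/ tau C * tau C + (j.-1 %% tau C).+1)%N.
  by rewrite addnS -divn_eq prednK.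
rewrite phi_block ?ltn_pmod//.
apply: (@cov_invariant _ _ _ F Q C (alpha (j.-1 %/ tau C)%N)
  (j.-1 %% tau C).+1); first exact: ltn_pmod.
eexists; last reflexivity.
by apply: Bx; rewrite ltn_divLR// prednK.
Qed.

Lemma eq_B_ n alpha beta : (forall i, (i < n)%N -> alpha i = beta i) ->
  B_ n alpha = B_ n beta.
Proof.
move=> ab; have phiE i x : (i < n)%N ->
    phi F (i * tau C) x (omega alpha) = phi F (i * tau C) x (omega beta).
  move=> ni; apply: eq_phi => l li; apply: (@eq_omega n) => //.
  by rewrite (ltn_trans li)// ltn_pmul2r// tau_gt0.
by apply/seteqP; split=> x Bx i ni; move: (Bx i ni); rewrite ab// phiE.
Qed.

Lemma B_splice m n alpha beta x :
  B_ m alpha x -> B_ n beta (phi F (m * tau C) x (omega alpha)) ->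
  B_ (m + n) (splice m alpha beta) x.
Proof.
move=> Ba Bb i imn; rewrite omega_splice; have [im|mi] := ltnP i m.
  rewrite phi_splice; last by rewrite leq_mul2r (ltnW im) orbT.
  by rewrite /splice im; exact: Ba.
rewrite -(subnKC mi) mulnDl phi_spliceD spliceD; apply: Bb.
by rewrite ltn_subLR.
Qed.

Lemma finite_cov_type : finite_set [set: cov C].
Proof.
have -> : [set: cov C] = set_val @^-1` cov C.
  by apply/seteqP; split => // A _; exact: set_valP.
apply: finite_preimage (cov_finite C) => A B _ _.
by rewrite set_valE; exact: val_inj.
Qed.

Definition words n (I : set (nat -> cov C)) : set (seq U) :=
  [set mkseq (omega alpha) (n * tau C)%N | alpha in I].

(** [B_ n alpha] only depends on [alpha] below [n], so every cover by such sets
    is essentially finite and has a minimal subcover. *)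
Lemma generating_subcover n (I : set (nat -> cov C)) :
  Q `<=` \bigcup_(alpha in I) B_ n alpha ->
  exists2 W, generating C n W & W `<=` words n I.
Proof.
(* If [I] is empty, then so is [Q], and the empty set of words is generating. Otherwise [alpha0]
   provides the default tail for truncations. *)
move=> QI; have [I0|/set0P[alpha0 _]] := eqVneq I set0.
  exists set0; last exact: sub0set.
  by exists set0; [split=> //; move: QI; rewrite I0|rewrite image_set0].
(* Truncation selects one representative per prefix; the cover being finite, only finitely many
   remain, as induction on the length shows. *)
pose pref n alpha i := if (i < n)%N then alpha i else alpha0 i.
have finpref k : finite_set (range (pref k)).
  elim: k => [|k IHk].
    by apply: (@sub_finite_set _ _ [set alpha0]) => // _ [alpha _ <-].
  pose upd (b : nat -> cov C) (A : cov C) i := if i == k then A else b i.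
  apply: (@sub_finite_set _ _ [set upd b A | b in range (pref k) & A in setT]).
    move=> _ [alpha _ <-]; exists (pref k alpha); first by exists alpha.
    exists (alpha k) => //; apply/funext => i; rewrite /upd /pref ltnS.
    by case: ltngtP => // ->.
  by apply: finite_image2 => //; exact: finite_cov_type.
have prefE alpha i : (i < n)%N -> pref n alpha i = alpha i.
  by rewrite /pref => ->.
have [||J [JI QJ minJ]] := @finite_subcover_minimal _ _ Q (pref n @` I) (B_ n).
- by apply: sub_finite_set (finpref n); exact: image_subset.
- move=> x /QI[alpha Ia Ba]; exists (pref n alpha); first by exists alpha.
  by rewrite (eq_B_ (prefE alpha)).
exists (words n J); first by exists J.
move=> _ [_ /JI[alpha Ia <-] <-]; exists alpha => //.
apply/eq_in_map => l; rewrite mem_iota /= add0n => ln.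
by apply: (@eq_omega n) => // i /prefE.
Qed.

(** For [n = 1] only the initial point is constrained, so constant sequences already cover [Q]. *)
Lemma generating1 :
  exists2 W, generating C 1 W &
    W `<=` [set tval (feedback A) | A in [set: cov C]].
Proof.
have [x Qx|W genW WC] := @generating_subcover 1 setT.
  have [A CA Ax] := @cov_cover _ _ _ F Q C x Qx.
  by exists (fun=> SigSub (mem_set CA)) => // -[].
exists W => // _ /WC[alpha _ <-]; exists (alpha 0%N) => //.
by rewrite -mkseq_omega_block mul1n.
Qed.

(** After [m] blocks the state is back in [Q], where the second cover applies. The spliced cover may
    fail to be minimal, so [Z] is only a part of the concatenations. *)
Lemma generating_concat m n (V W : set (seq U)) :
  (0 < m)%N -> generating C m V -> generating C n W ->
  exists2 Z, generating C (m + n) Z & Z `<=` [set s1 ++ s2 | s1 in V & s2 in W].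
Proof.
move=> m0 [I [QI _] ->] [J [QJ _] ->].
have [|Z genZ ZI] := @generating_subcover (m + n)
    [set splice m alpha beta | alpha in I & beta in J].
  move=> x /QI[alpha Ia Ba]; have := B_inner_entry Ba.
  move=> /(_ (m * tau C)%N)/[!leqnn]/[!andbT]/[!muln_gt0]/[!m0]/=.
  move=> /(_ (tau_gt0 C))/interior_subset/QJ[beta Jb Bb].
  exists (splice m alpha beta); last exact: B_splice.
  by exists alpha => //; exists beta.
exists Z => // _ /ZI[_ [alpha Ia [beta Jb <-]] <-].
exists (mkseq (omega alpha) (m * tau C)); first by exists alpha.
exists (mkseq (omega beta) (n * tau C)); first by exists beta.
by rewrite omega_splice mulnDl mkseq_splice.
Qed.

Lemma P_fb_coverE f :
  P_fb_cover C f =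
  ereal_inf [set (((n * tau C)%:R^-1)%:E * lne (q_ C f n))%E
            | n in [set n | (0 < n)%N]].
Proof.
apply: (@limn_lne_inf_submul R _
  (fun n => [set \esum_(s in W) weight f s | W in generating C n])).
- exact: tau_gt0.
- by move=> n _ [W _ <-]; apply: esum_ge0 => s _; exact: weight_ge0.
- have [W genW WC] := generating1; eexists; first by exists W.
  apply: (le_lt_trans (subset_esum _ WC)).
  apply: (esum_finite_ltoo f id); apply: finite_image.
  exact: finite_cov_type.
- move=> m n _ _ m0 n0 [V genV <-] [W genW <-].
  have [Z genZ ZVW] := generating_concat m0 genV genW.
  eexists; first by exists Z.
  apply: (le_trans (subset_esum _ ZVW)).
  apply: esum_image2_le => [s|s|s1 s2]; rewrite ?weight_ge0//.
  exact: weight_cat.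
Qed.

Lemma a_le_q f n : U -> (a_ F f Q (n * tau C) <= q_ C f n)%E.
Proof.
move=> u0; apply: le_ereal_inf_tmp => _ [_ [I [QI _] ->] <-].
apply: ge_ereal_inf; eexists.
  (* Each finite word is padded with [u0] to an infinite control; only its first [n * tau C] entries
     matter. *)
  exists (nth u0 @` words n I) => //= x /QI[alpha Ia Ba].
  exists (nth u0 (mkseq (omega alpha) (n * tau C))).
    by eexists; [exists alpha|].
  move=> i i0n; rewrite (_ : phi F i x _ = phi F i x (omega alpha)).
    exact: B_inner_entry Ba i i0n.
  apply: eq_phi => l li; rewrite nth_mkseq// (leq_trans li)//.
  by case/andP: i0n.
apply: (le_trans (esum_image_le _ _ _)); apply: le_esum => _ [alpha _ <-].
by rewrite -[X in mkseq _ X](size_mkseq (omega alpha) (n * tau C)) mkseq_nth.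
Qed.

End Cover.

(** * Comparison of the two pressures *)

Lemma cover_of_spanning F Q n (D : set (nat -> U)) :
  (forall u, continuous (F ^~ u)) -> (0 < n)%N -> finite_set D ->
  strongly_spanning F Q n D ->
  exists2 C : inv_open_cover F Q, tau C = n &
    forall A : cov C, exists2 w, D w & tval (feedback A) = mkseq w n.
Proof.
move=> cF n0 finD spD.
pose cv := [set Q `&` inner_entry F Q n w | w in D].
(* Different controls of [D] may define the same cover element, so one control is chosen for each
   element. *)
have /choice[g gP] (A : cv) :
    exists w, D w /\ Q `&` inner_entry F Q n w = set_val A.
  by have [w Dw wA] := set_valP A; exists w.
pose fb (A : cv) := Tuple (introT eqP (size_mkseq (g A) n)).
have cvF : finite_set cv by exact: finite_image.
have cvO A : cv A -> exists2 O, open O & A = Q `&` O.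
  move=> [w _ <-]; exists (inner_entry F Q n w) => //.
  exact: open_inner_entry.
have cvQ : Q `<=` \bigcup_(A in cv) A.
  move=> x Qx; have [w Dw Hw] := spD x Qx.
  by exists (Q `&` inner_entry F Q n w) => //; exists w.
have cvI (A : cv) k : (1 <= k <= n)%N ->
    [set phi_word F k x (fb A) | x in set_val A] `<=` Q°.
  move=> k1n _ [x Ax <-]; rewrite phi_wordE; last by case/andP: k1n.
  by move: Ax; have [_ <-] := gP A => -[_]; apply.
exists (InvOpenCover n0 cvF cvO cvQ cvI) => // A.
by exists (g A) => //; have [] := gP A.
Qed.

End Systems.

Theorem theorem11 (R : realType) (X : metricType R) (U : topologicalType)
    (F : X -> U -> X) (hF : forall u : U, continuous (fun x : X => F x u))
    (f : U -> R) (hf : continuous f)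
    (Q : set X) (hQ : strongly_invariant F Q) :
  P_int F f Q = P_fb F f Q.
Proof.
have [_ [x0 /interior_subset Qx0] /(_ _ Qx0)[u0 _]] := hQ.
have a0 (S : set (nat -> U)) n : (0 <= \esum_(w in S) weight f (mkseq w n))%E.
  by apply: esum_ge0 => w _; exact: weight_ge0.
rewrite P_intE//; apply/eqP; rewrite eq_le; apply/andP; split.
  apply: le_ereal_inf_tmp => _ [C _ <-]; rewrite P_fb_coverE.
  apply: le_ereal_inf_tmp => _ [n n0 <-].
  have nt0 : (0 < n * tau C)%N by rewrite muln_gt0 n0 tau_gt0.
  apply: ge_ereal_inf; eexists; first by exists (n * tau C)%N.
  rewrite lee_wpmul2l ?lee_fin ?invr_ge0//.
  apply: le_lne; last exact: a_le_q.
  by apply: le_ereal_inf_tmp => _ [S _ <-]; exact: a0.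
(* Arguing by contradiction replaces the infimum [a_ F f Q n] by the sum over a single spanning set
   [S], without any epsilon. *)
apply: le_ereal_inf_tmp => _ [n n0 <-]; rewrite leNgt; apply/negP.
have nR0 : 0 < n%:R :> R by rewrite ltr0n.
rewrite lte_pdivrMl// lne_lt; last first.
  by apply: le_ereal_inf_tmp => _ [S _ <-]; exact: a0.
move=> /ereal_inf_lt[_ [S spS <-]].
rewrite -lne_lt ?a0// -lte_pdivrMl//; apply/negP; rewrite -leNgt.
have [D [finD DS spD]] := strongly_spanning_finite hF hQ spS.
have [C tC fbC] := cover_of_spanning hF n0 finD spD.
have [W genW WC] := generating1 C.
apply: ge_ereal_inf; exists (P_fb_cover C f); first by exists C.
(* One block suffices: it has length [tau C = n], and the cover pressure is an infimum over all
   block counts. *)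
rewrite P_fb_coverE; apply: ge_ereal_inf; eexists; first by exists 1%N.
rewrite mul1n tC lee_wpmul2l ?lee_fin ?invr_ge0//; apply: le_lne.
  apply: le_ereal_inf_tmp => _ [V _ <-]; apply: esum_ge0 => s _.
  exact: weight_ge0.
apply: ge_ereal_inf; eexists; first by exists W.
apply: (@le_trans _ _ (\esum_(s in [set mkseq w n | w in D]) weight f s)).
  apply: subset_esum => _ /WC[A _ <-].
  by have [w Dw ->] := fbC A; exists w.
by apply: (le_trans (esum_image_le _ _ _)); exact: subset_esum.
Qed.
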